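(* Let $d,s,\nu$ be positive integers, let $\boldsymbol n\in\mathbb N^d$, and let $\{\Omega_1,\ldots,\Omega_\nu\}$ be a partition of $[0,1]^d$. Then $$P_{\Omega_1,\ldots,\Omega_\nu}^{AS,\boldsymbol n,s}(A)=P_{\Omega_1,\ldots,\Omega_\nu}^{BJ,\boldsymbol n,s,s}(A)\quad\text{for every }A\in D^{AS,\boldsymbol n,s}_{\Omega_1,\ldots,\Omega_\nu},$$ $$P_{\Omega_1,\ldots,\Omega_\nu}^{MS,\boldsymbol n,s}(A)=P_{\Omega_1,\ldots,\Omega_\nu}^{BGS,\boldsymbol n,s,s}(A)\quad\text{for every }A\in D^{MS,\boldsymbol n,s}_{\Omega_1,\ldots,\Omega_\nu}.$$
   Context: **Multi-indices.** $\mathbb N=\{1,2,3,\ldots\}$, $\mathbf 1=(1,\ldots,1)$. For $\boldsymbol n\in\mathbb N^d$, $N(\boldsymbol n)=n_1n_2\cdots n_d$. The range $\{\mathbf 1,\ldots,\boldsymbol n\}$ is $\{\boldsymbol i\in\mathbb Z^d:1\le i_k\le n_k\ \forall k\}$, ordered lexicographically. Vector operations are componentwise, e.g. $\boldsymbol i/\boldsymbol n=(i_1/n_1,\ldots,i_d/n_d)$. A matrix $A$ of size $N(\boldsymbol n)s\times N(\boldsymbol n)s$ is viewed as a block matrix $A=[A_{\boldsymbol i\boldsymbol j}]_{\boldsymbol i,\boldsymbol j=\mathbf 1}^{\boldsymbol n}$ with $s\times s$ blocks. For $\Omega\subseteq\mathbb R^d$, $\mathcal I_{\boldsymbol n}^\Omega=\{\boldsymbol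 i\in\{\mathbf 1,\ldots,\boldsymbol n\}:\boldsymbol i/\boldsymbol n\in\Omega\}$ and $N_{\boldsymbol n}^\Omega=|\mathcal I_{\boldsymbol n}^\Omega|$. $\chi_\Omega$ is the characteristic function of $\Omega$, $I_s$ the $s\times s$ identity. A partition of $[0,1]^d$ is a family of pairwise disjoint sets whose union is $[0,1]^d$. **BJ/BGS preconditioners.** For $a:[0,1]^d\to\mathbb C^{s\times s}$, $D_{\boldsymbol n}(a)$ is the $N(\boldsymbol n)s\times N(\boldsymbol n)s$ block diagonal matrix with $(\boldsymbol i,\boldsymbol i)$ block $a(\boldsymbol i/\boldsymbol n)$. For $\Omega_L,\Omega_R\subseteq[0,1]^d$, $Z_{\Omega_L,\Omega_R}^{\boldsymbol n,s,s}(A)=D_{\boldsymbol n}(\chi_{\Omega_L}I_s)\,A\,D_{\boldsymbol n}(\chi_{\Omega_R}I_s)$. For a partition $\{\Omega_1,\ldots,\Omega_\nu\}$ of $[0,1]^d$ (in the given order), $$P_{\Omega_1,\ldots,\Omega_\nu}^{BJ,\boldsymbol n,s,s}(A)=\sum_{i=1}^\nu Z_{\Omega_i,\Omega_i}^{\boldsymbol n,s,s}(A),\qquad P_{\Omega_1,\ldots,\Omega_\nu}^{BGS,\boldsymbol n,s,s}(A)=\sum_{1\le j\le i\le\nu}Z_{\Omega_i,\Omega_j}^{\boldsymbol n,s,s}(A).$$ **AS/MS preconditioners.** For $\Omega\subseteq[0,1]^d$, the restriction matrix $R_\Omega^{\boldsymbol n,s}$ is the $N_{\boldsymbol n}^\Omega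 s\times N(\boldsymbol n)s$ matrix obtained from $D_{\boldsymbol n}(\chi_\Omega I_s)$ by removing the block rows with multi-index $\boldsymbol i\notin\mathcal I_{\boldsymbol n}^\Omega$. Let $R_{\Omega,\Omega}^{\boldsymbol n,s,s}(A)=R_\Omega^{\boldsymbol n,s}A(R_\Omega^{\boldsymbol n,s})^T$, and for $B\in\mathbb C^{N_{\boldsymbol n}^\Omega s\times N_{\boldsymbol n}^\Omega s}$ let $E_{\Omega,\Omega}^{\boldsymbol n,s,s}(B)=(R_\Omega^{\boldsymbol n,s})^TBR_\Omega^{\boldsymbol n,s}$. Put $\mathrm{RIE}_\Omega^{\boldsymbol n,s}(A)=E_{\Omega,\Omega}^{\boldsymbol n,s,s}\bigl(R_{\Omega,\Omega}^{\boldsymbol n,s,s}(A)^{-1}\bigr)$, with domain $D_\Omega^{\mathrm{RIE},\boldsymbol n,s}=\{A\in\mathbb C^{N(\boldsymbol n)s\times N(\boldsymbol n)s}:R_{\Omega,\Omega}^{\boldsymbol n,s,s}(A)\text{ is invertible}\}$. For sets $\Omega_1,\ldots,\Omega_\nu\subseteq[0,1]^d$ with union $[0,1]^d$, $$P_{\Omega_1,\ldots,\Omega_\nu}^{AS,\boldsymbol n,s}(A)=\Bigl[\sum_{i=1}^\nu\mathrm{RIE}_{\Omega_i}^{\boldsymbol n,s}(A)\Bigr]^{-1},\qquad P_{\Omega_1,\ldots,\Omega_\nu}^{MS,\boldsymbol n,s}(A)=A\Bigl[I-\prod_{i=\nu}^1\bigl(I-\mathrm{RIE}_{\Omega_i}^{\boldsymbol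 n,s}(A)A\bigr)\Bigr]^{-1},$$ where $\prod_{i=\nu}^1X_i=X_\nu X_{\nu-1}\cdots X_1$. The domain $D^{AS,\boldsymbol n,s}_{\Omega_1,\ldots,\Omega_\nu}$ is the set of $A\in\bigcap_{i=1}^\nu D_{\Omega_i}^{\mathrm{RIE},\boldsymbol n,s}$ such that $\sum_{i=1}^\nu\mathrm{RIE}_{\Omega_i}^{\boldsymbol n,s}(A)$ is invertible; the domain $D^{MS,\boldsymbol n,s}_{\Omega_1,\ldots,\Omega_\nu}$ is the set of $A\in\bigcap_{i=1}^\nu D_{\Omega_i}^{\mathrm{RIE},\boldsymbol n,s}$ such that $I-\prod_{i=\nu}^1(I-\mathrm{RIE}_{\Omega_i}^{\boldsymbol n,s}(A)A)$ is invertible. *)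

(* Defs.v *)
From HB Require Import structures.
From mathcomp Require Import all_boot all_order all_algebra.
From mathcomp Require Import all_classical all_reals numfun.
From mathcomp Require Import complex.

Set Implicit Arguments.
Unset Strict Implicit.
Unset Printing Implicit Defensive.

Import GRing.Theory.
Local Open Scope classical_set_scope.
Local Open Scope ring_scope.

Definition unit_cube (R : realType) (d : nat) : set 'rV[R]_d :=
  [set x : 'rV[R]_d | forall k, 0 <= x ord0 k <= 1].

Arguments unit_cube : clear implicits.

(* The members of a partition are allowed to be empty. *)
Definition is_partition (T : Type) (nu : nat) (Omega : 'I_nu -> set T)
    (X : set T) : Prop :=
  trivIset [set: 'I_nu] Omega /\ \bigcup_(i in [set: 'I_nu]) Omega i = X.

Definition mi_card (d : nat) (n : 'I_d -> nat) : nat := (\prod_(k < d) n k)%N.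

(* [multi_index q] is the multi-index whose position is [q] (counted from 0)
   when the range {1,..,n} is ordered lexicographically: [multi_index q k - 1]
   is the mixed-radix digit of [q] whose weight is the product of the [n l]
   with [l > k]. *)
Definition multi_index (d : nat) (n : 'I_d -> nat) (q : 'I_(mi_card n))
    (k : 'I_d) : nat :=
  ((q %/ \prod_(l < d | (k < l)%N) n l) %% n k).+1%N.

(* i / n, where i is the multi-index at position q *)
Definition grid_point (R : realType) (d : nat) (n : 'I_d -> nat)
    (q : 'I_(mi_card n)) : 'rV[R]_d :=
  \row_(k < d) ((multi_index q k)%:R / (n k)%:R).

(* Block matrices with s x s blocks use the library's block format, whose
   dimension N(n) s is written as a sum of block sizes; blocks are indexed by
   the lexicographic position of the multi-index. *)
Definition bsize (d : nat) (n : 'I_d -> nat) (s : nat) : nat :=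
  (\sum_(q < mi_card n) s)%N.

(* The symbol a is a function on R^d; only its values on the grid, a subset of
   the unit cube, are used. *)
Definition diag_sampling (R : realType) (d : nat) (n : 'I_d -> nat) (s : nat)
    (a : 'rV[R]_d -> 'M[R[i]]_s) : 'M[R[i]]_(bsize n s) :=
  \mxdiag_(q < mi_card n) a (grid_point R q).

Definition diag_indic (R : realType) (d : nat) (n : 'I_d -> nat) (s : nat)
    (Omega : set 'rV[R]_d) : 'M[R[i]]_(bsize n s) :=
  diag_sampling n (fun x => \1_Omega x *: (1%:M : 'M[R[i]]_s)).

Definition Zop (R : realType) (d : nat) (n : 'I_d -> nat) (s : nat)
    (OmegaL OmegaR : set 'rV[R]_d) (A : 'M[R[i]]_(bsize n s)) :
    'M[R[i]]_(bsize n s) :=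
  diag_indic n s OmegaL *m A *m diag_indic n s OmegaR.

Definition P_BJ (R : realType) (d : nat) (n : 'I_d -> nat) (s nu : nat)
    (Omega : 'I_nu -> set 'rV[R]_d) (A : 'M[R[i]]_(bsize n s)) :
    'M[R[i]]_(bsize n s) :=
  \sum_(i < nu) Zop (Omega i) (Omega i) A.

Definition P_BGS (R : realType) (d : nat) (n : 'I_d -> nat) (s nu : nat)
    (Omega : 'I_nu -> set 'rV[R]_d) (A : 'M[R[i]]_(bsize n s)) :
    'M[R[i]]_(bsize n s) :=
  \sum_(i < nu) \sum_(j < nu | (j <= i)%N) Zop (Omega i) (Omega j) A.

Definition grid_in (R : realType) (d : nat) (n : 'I_d -> nat)
    (Omega : set 'rV[R]_d) : {set 'I_(mi_card n)} :=
  finset (fun q => grid_point R q \in Omega).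

(* N_n^Omega * s *)
Definition rsize (R : realType) (d : nat) (n : 'I_d -> nat) (s : nat)
    (Omega : set 'rV[R]_d) : nat :=
  (\sum_(k < #|grid_in n Omega|) s)%N.

(* [enum_val] lists the positions in [grid_in n Omega] in increasing order. *)
Definition restr_mx (R : realType) (d : nat) (n : 'I_d -> nat) (s : nat)
    (Omega : set 'rV[R]_d) : 'M[R[i]]_(rsize n s Omega, bsize n s) :=
  \mxcol_(k < #|grid_in n Omega|) submxcol (diag_indic n s Omega) (enum_val k).

Definition Rop (R : realType) (d : nat) (n : 'I_d -> nat) (s : nat)
    (Omega : set 'rV[R]_d) (A : 'M[R[i]]_(bsize n s)) :
    'M[R[i]]_(rsize n s Omega) :=
  restr_mx n s Omega *m A *m (restr_mx n s Omega)^T.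

Definition Eop (R : realType) (d : nat) (n : 'I_d -> nat) (s : nat)
    (Omega : set 'rV[R]_d) (B : 'M[R[i]]_(rsize n s Omega)) :
    'M[R[i]]_(bsize n s) :=
  (restr_mx n s Omega)^T *m B *m restr_mx n s Omega.

(* [RIE], [P_AS] and [P_MS] are total because [invmx M = M] when M is not
   invertible; they carry their intended meaning on the domains below. *)
Definition RIE (R : realType) (d : nat) (n : 'I_d -> nat) (s : nat)
    (Omega : set 'rV[R]_d) (A : 'M[R[i]]_(bsize n s)) :
    'M[R[i]]_(bsize n s) :=
  Eop (invmx (Rop Omega A)).

Definition dom_RIE (R : realType) (d : nat) (n : 'I_d -> nat) (s : nat)
    (Omega : set 'rV[R]_d) : set 'M[R[i]]_(bsize n s) :=
  [set A | Rop Omega A \in unitmx].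

Arguments dom_RIE {R d} n s Omega.

Definition AS_sum (R : realType) (d : nat) (n : 'I_d -> nat) (s nu : nat)
    (Omega : 'I_nu -> set 'rV[R]_d) (A : 'M[R[i]]_(bsize n s)) :
    'M[R[i]]_(bsize n s) :=
  \sum_(i < nu) RIE (Omega i) A.

(* The product is X_nu *m ... *m X_1 with X_i = I - RIE_i(A) A. *)
Definition MS_factor (R : realType) (d : nat) (n : 'I_d -> nat) (s nu : nat)
    (Omega : 'I_nu -> set 'rV[R]_d) (A : 'M[R[i]]_(bsize n s)) :
    'M[R[i]]_(bsize n s) :=
  1%:M - \big[mulmx/1%:M]_(i < nu) (1%:M - RIE (Omega (rev_ord i)) A *m A).

Definition P_AS (R : realType) (d : nat) (n : 'I_d -> nat) (s nu : nat)
    (Omega : 'I_nu -> set 'rV[R]_d) (A : 'M[R[i]]_(bsize n s)) :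
    'M[R[i]]_(bsize n s) :=
  invmx (AS_sum Omega A).

Definition P_MS (R : realType) (d : nat) (n : 'I_d -> nat) (s nu : nat)
    (Omega : 'I_nu -> set 'rV[R]_d) (A : 'M[R[i]]_(bsize n s)) :
    'M[R[i]]_(bsize n s) :=
  A *m invmx (MS_factor Omega A).

Definition dom_AS (R : realType) (d : nat) (n : 'I_d -> nat) (s nu : nat)
    (Omega : 'I_nu -> set 'rV[R]_d) : set 'M[R[i]]_(bsize n s) :=
  (\bigcap_(i in [set: 'I_nu]) dom_RIE n s (Omega i)) `&`
  [set A | AS_sum Omega A \in unitmx].

Definition dom_MS (R : realType) (d : nat) (n : 'I_d -> nat) (s nu : nat)
    (Omega : 'I_nu -> set 'rV[R]_d) : set 'M[R[i]]_(bsize n s) :=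
  (\bigcap_(i in [set: 'I_nu]) dom_RIE n s (Omega i)) `&`
  [set A | MS_factor Omega A \in unitmx].

Arguments dom_AS {R d} n s {nu} Omega.
Arguments dom_MS {R d} n s {nu} Omega.

(* Main.v *)
Require Import Defs.
From mathcomp Require Import all_boot all_order all_algebra.
From mathcomp Require Import all_classical all_reals numfun.
From mathcomp Require Import complex.

(** Write [E_i] for the block diagonal 0/1 matrix that selects the grid points
    of [Omega_i], and [G_i] for the local solver [RIE_i(A)]. The restriction
    matrix [R_i] has orthonormal rows and satisfies [R_i^T R_i = E_i]
    ([restr_mx_mul_tr], [restr_mx_tr_mul]), so that
      [G_i = E_i G_i = G_i E_i] and [G_i A E_i = E_i = E_i A G_i].
    Because the [Omega_i] partition a set containing the whole grid, the [E_i]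
    are orthogonal and sum to the identity. These relations reduce the
    theorem to two identities in a noncommutative ring.

    Additive case ([additive_schwarz_mul_block_jacobi]): the [G_i] live on
    disjoint diagonal blocks, where they invert [E_i A E_i], so
    [(\sum_i G_i) (\sum_i E_i A E_i) = \sum_i E_i = 1].

    Multiplicative case ([block_gauss_seidel_mul_error]): the product
    [P_k = (1 - G_k A) ... (1 - G_1 A)] propagates the error through the first
    [k] local solves of a sweep. Solve [i] changes only the components in
    [Omega_i], so the components in [Omega_1], ..., [Omega_i] have their final
    values as soon as solve [i] is done, while the others are still untouched:
    [\sum_(j <= i) E_j (1 - P_nu) = 1 - P_i]. Moreover solve [i] annihilates
    the residual on [Omega_i], that is [E_i A P_i = 0]. Hence block row [i] of
    the block lower triangular part [L] of [A] satisfies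
    [E_i L (1 - P_nu) = E_i A (1 - P_i) = E_i A]. Summing over [i] gives
    [L (1 - P_nu) = A], which is [P_MS = L] once [1 - P_nu] is invertible. *)

Set Implicit Arguments.
Unset Strict Implicit.
Unset Printing Implicit Defensive.

Import GRing.Theory Num.Theory.
Local Open Scope classical_set_scope.
Local Open Scope ring_scope.

(** * Schwarz sweeps in a noncommutative ring *)

(** The products [G_i E_j A E_j] with [i != j] vanish, and the diagonal ones
    are [E_i]: local inverses assemble to a global one. *)
Lemma additive_schwarz_mul_block_jacobi (T : pzRingType) (nu : nat)
    (E G : 'I_nu -> T) (A : T) :
  (forall i j, i != j -> G i * E j = 0) -> (forall i, G i * E i = G i) ->
  (forall i, G i * A * E i = E i) -> \sum_i E i = 1 ->
  (\sum_i G i) * (\sum_i E i * A * E i) = 1.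
Proof.
move=> GE0 GE GAE <-; rewrite mulr_suml; apply: eq_bigr => i _.
rewrite mulr_sumr (bigD1 i) //= big1 ?addr0; first by rewrite !mulrA GE GAE.
by move=> j ji; rewrite !mulrA GE0 ?mul0r // eq_sym.
Qed.

(** The error after the first [k] steps of a sweep, with later steps on the
    left. Indexing by [nat] lets prefixes of the sweep be compared without
    coercing between ordinal types. *)
Definition sweep_error (T : pzRingType) (A : T) (G : nat -> T) (k : nat) : T :=
  \prod_(i < k) (1 - G (k - i.+1)%N * A).

Lemma sweep_error0 (T : pzRingType) (A : T) (G : nat -> T) :
  sweep_error A G 0 = 1.
Proof. by rewrite /sweep_error big_ord0. Qed.

Lemma sweep_errorS (T : pzRingType) (A : T) (G : nat -> T) k :
  sweep_error A G k.+1 = (1 - G k * A) * sweep_error A G k.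
Proof. by rewrite /sweep_error big_ord_recl /= subn1. Qed.

(** Correction [i] is a multiple of [G i], so the component selected by [e] does
    not see it when [e * G i] vanishes. *)
Lemma sweep_error_frozen (T : pzRingType) (A e : T) (G : nat -> T) (l k : nat) :
  (l <= k)%N -> (forall i, (l <= i < k)%N -> e * G i = 0) ->
  e * sweep_error A G k = e * sweep_error A G l.
Proof.
elim: k => [|k IHk]; first by rewrite leqn0 => /eqP->.
rewrite leq_eqVlt => /predU1P[-> //|]; rewrite ltnS => le_lk eG0.
rewrite sweep_errorS mulrA mulrBr mulr1 mulrA eG0 ?le_lk ?ltnSn //.
rewrite mul0r subr0; apply: IHk => // i /andP[le_li lt_ik].
by apply: eG0; rewrite le_li ltnS ltnW.
Qed.

(** The double sum is the block lower triangular part of [A]. The proof pairs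
    two facts about step [i]: the components up to [i] have reached their final
    values ([settled]), and the residual vanishes on the [i]-th component
    ([residual0]). *)
Lemma block_gauss_seidel_mul_error (T : pzRingType) (A : T) (E G : nat -> T)
    (nu : nat) :
  (forall i j, (i < nu)%N -> (j < nu)%N -> i != j -> E i * G j = 0) ->
  (forall i, (i < nu)%N -> E i * A * G i = E i) ->
  \sum_(i < nu) E i = 1 ->
  (\sum_(i < nu) \sum_(j < nu | (j <= i)%N) E i * A * E j)
    * (1 - sweep_error A G nu) = A.
Proof.
move=> EG0 EAG sumE.
have settled (i : 'I_nu) :
    (\sum_(j < nu | (j <= i)%N) E j) * (1 - sweep_error A G nu)
    = 1 - sweep_error A G i.+1.
  transitivity ((\sum_(j < nu) E j) * (1 - sweep_error A G i.+1)); last first.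
    by rewrite sumE mul1r.
  rewrite !mulr_suml [RHS](bigID (fun j : 'I_nu => (j <= i)%N)).
  rewrite /= [X in _ = _ + X]big1 ?addr0 => [|j]; last first.
    rewrite -ltnNge => lt_ij.
    rewrite mulrBr (@sweep_error_frozen _ _ _ _ 0) // => [|m /= lt_mi].
      by rewrite sweep_error0 subrr.
    apply: EG0 => //; first exact: leq_trans lt_mi _.
    by rewrite gtn_eqF // (leq_trans lt_mi).
  apply: eq_bigr => j le_ji; rewrite !mulrBr; congr (_ - _).
  apply: sweep_error_frozen => // m /andP[lt_im lt_m].
  by apply: EG0 => //; rewrite ltn_eqF // (leq_ltn_trans le_ji).
have residual0 (i : 'I_nu) : E i * A * sweep_error A G i.+1 = 0.
  by rewrite sweep_errorS mulrA mulrBr mulr1 mulrA EAG // subrr mul0r.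
transitivity (\sum_(i < nu) E i * A); last by rewrite -mulr_suml sumE mul1r.
rewrite mulr_suml; apply: eq_bigr => i _.
by rewrite -mulr_sumr -mulrA settled mulrBr mulr1 residual0 subr0.
Qed.

(** Carries a family over the subdomains to the indexing by [nat] that
    [sweep_error] uses. *)
Definition ext0 (T : nmodType) (nu : nat) (F : 'I_nu -> T) (k : nat) : T :=
  oapp F 0 (insub k).

Lemma ext0E (T : nmodType) (nu : nat) (F : 'I_nu -> T) (i : 'I_nu) :
  ext0 F i = F i.
Proof. by rewrite /ext0 valK. Qed.

(** * Restriction matrices and selection matrices *)

Lemma diag_indicE (R : realType) (d : nat) (n : 'I_d -> nat) (s : nat)
    (Omega : set 'rV[R]_d) :
  diag_indic n s Omega =
  \mxdiag_(q < mi_card n) ((grid_point R q \in Omega)%:R%:M : 'M[R[i]]_s).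
Proof. by apply: eq_mxdiag => q; rewrite indicE scalemx1. Qed.

Lemma submxcol_diag_indic (R : realType) (d : nat) (n : 'I_d -> nat) (s : nat)
    (Omega : set 'rV[R]_d) (q : 'I_(mi_card n)) :
  submxcol (diag_indic n s Omega) q =
  (grid_point R q \in Omega)%:R *: submxcol (1%:M : 'M[R[i]]_(bsize n s)) q.
Proof.
rewrite -[diag_indic n s Omega]mulmx1.
rewrite -[X in _ *m X](submxcolK (1%:M : 'M[R[i]]_(bsize n s))).
by rewrite diag_indicE mul_mxdiag_mxcol mxcolK mul_scalar_mx.
Qed.

Lemma diag_indic_mul (R : realType) (d : nat) (n : 'I_d -> nat) (s : nat)
    (Omega1 Omega2 : set 'rV[R]_d) :
  diag_indic n s Omega1 *m diag_indic n s Omega2 =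
  diag_indic n s (Omega1 `&` Omega2).
Proof.
rewrite -[LHS]submxcolK -[RHS]submxcolK; apply: eq_mxcol => q.
by rewrite -submxcol_mul !submxcol_diag_indic -scalemxAl submxcol_mul mul1mx
  submxcol_diag_indic scalerA in_setI -natrM mulnb.
Qed.

Lemma diag_indic0 (R : realType) (d : nat) (n : 'I_d -> nat) (s : nat) :
  diag_indic n s (set0 : set 'rV[R]_d) = 0.
Proof.
rewrite -[LHS]submxcolK -[RHS]submxcolK; apply: eq_mxcol => q.
by rewrite submxcol_diag_indic in_set0 scale0r submxcol0.
Qed.

Lemma restr_mxE (R : realType) (d : nat) (n : 'I_d -> nat) (s : nat)
    (Omega : set 'rV[R]_d) :
  restr_mx n s Omega =
  \mxcol_(k < #|grid_in n Omega|)
     submxcol (1%:M : 'M[R[i]]_(bsize n s)) (enum_val k).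
Proof.
apply: eq_mxcol => k; rewrite submxcol_diag_indic.
by have := enum_valP k; rewrite inE => ->; rewrite scale1r.
Qed.

(** The rows of the restriction matrix are distinct rows of the identity. *)
Lemma restr_mx_mul_tr (R : realType) (d : nat) (n : 'I_d -> nat) (s : nat)
    (Omega : set 'rV[R]_d) :
  restr_mx n s Omega *m (restr_mx n s Omega)^T = 1%:M.
Proof.
rewrite restr_mxE tr_mxcol mul_mxcol_mxrow; apply/mxblockP => k l.
rewrite mxblockK tr_submxcol tr_scalar_mx mul_submxrow mulmx1 -submxblockEv.
by rewrite -!mxdiagZ !mxblockK (inj_eq enum_val_inj).
Qed.

(** Both sides are [\sum_q S_q^T S_q] over the grid points [q] in [Omega], where
    [S_q] is the [q]-th block row of the identity. *)
Lemma restr_mx_tr_mul (R : realType) (d : nat) (n : 'I_d -> nat) (s : nat)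
    (Omega : set 'rV[R]_d) :
  (restr_mx n s Omega)^T *m restr_mx n s Omega = diag_indic n s Omega.
Proof.
pose S q := submxcol (1%:M : 'M[R[i]]_(bsize n s)) q.
transitivity (\sum_(q in grid_in n Omega) (S q)^T *m S q).
  by rewrite restr_mxE tr_mxcol mul_mxrow_mxcol [RHS]big_enum_val.
rewrite -[RHS]mul1mx -[X in X *m _]trmx1.
rewrite -[X in X^T *m _](submxcolK (1%:M : 'M[R[i]]_(bsize n s))).
rewrite -[X in _ *m X](submxcolK (diag_indic n s Omega)).
rewrite tr_mxcol mul_mxrow_mxcol big_mkcond; apply: eq_bigr => q _.
rewrite submxcol_diag_indic inE.
by case: (_ \in Omega); rewrite ?scale1r ?scale0r ?mulmx0.
Qed.

Lemma RIE_mul_indic (R : realType) (d : nat) (n : 'I_d -> nat) (s : nat)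
    (Omega : set 'rV[R]_d) (A : 'M[R[i]]_(bsize n s)) :
  RIE Omega A *m diag_indic n s Omega = RIE Omega A.
Proof.
by rewrite /RIE /Eop -restr_mx_tr_mul !mulmxA -(mulmxA _ (restr_mx _ _ _))
  restr_mx_mul_tr mulmx1.
Qed.

Lemma indic_mul_RIE (R : realType) (d : nat) (n : 'I_d -> nat) (s : nat)
    (Omega : set 'rV[R]_d) (A : 'M[R[i]]_(bsize n s)) :
  diag_indic n s Omega *m RIE Omega A = RIE Omega A.
Proof.
by rewrite /RIE /Eop -restr_mx_tr_mul !mulmxA -(mulmxA _ (restr_mx _ _ _))
  restr_mx_mul_tr mulmx1.
Qed.

(** Once [diag_indic] is written [R^T R], a factor [R A R^T] appears next to its
    inverse; likewise on the other side. *)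
Lemma RIE_mul_indic_local (R : realType) (d : nat) (n : 'I_d -> nat) (s : nat)
    (Omega : set 'rV[R]_d) (A : 'M[R[i]]_(bsize n s)) :
  Rop Omega A \in unitmx ->
  RIE Omega A *m A *m diag_indic n s Omega = diag_indic n s Omega.
Proof.
move=> uA; rewrite /RIE /Eop -restr_mx_tr_mul.
rewrite !mulmxA -(mulmxA _ (restr_mx _ _ _)) -(mulmxA _ (_ *m A)).
by rewrite mulmxKV.
Qed.

Lemma indic_mul_RIE_local (R : realType) (d : nat) (n : 'I_d -> nat) (s : nat)
    (Omega : set 'rV[R]_d) (A : 'M[R[i]]_(bsize n s)) :
  Rop Omega A \in unitmx ->
  diag_indic n s Omega *m A *m RIE Omega A = diag_indic n s Omega.
Proof.
move=> uA; rewrite /RIE /Eop -restr_mx_tr_mul.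
rewrite !mulmxA -(mulmxA _ (restr_mx _ _ _)) -(mulmxA _ (_ *m A)).
by rewrite mulmxK.
Qed.

(** * Partitions of the unit cube *)

Lemma grid_point_in_cube (R : realType) (d : nat) (n : 'I_d -> nat)
    (hn : forall k, (0 < n k)%N) (q : 'I_(mi_card n)) :
  unit_cube R d (grid_point R q).
Proof.
move=> k; rewrite mxE divr_ge0 ?ler0n //=.
by rewrite ler_pdivrMr ?ltr0n // mul1r ler_nat /multi_index ltn_pmod.
Qed.

(** Every grid point lies in the cube, hence in exactly one [Omega_i]. *)
Lemma sum_diag_indic (R : realType) (d s nu : nat) (n : 'I_d -> nat)
    (hn : forall k, (0 < n k)%N) (Omega : 'I_nu -> set 'rV[R]_d) :
  is_partition Omega (unit_cube R d) ->
  \sum_(i < nu) diag_indic n s (Omega i) = 1%:M.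
Proof.
move=> [/trivIsetP tO cO]; rewrite -[LHS]submxcolK -[RHS]submxcolK.
apply: eq_mxcol => q; rewrite submxcol_sum.
have := @grid_point_in_cube R _ _ hn q; rewrite -cO => -[i _ Oi].
rewrite (bigD1 i) //= big1 ?addr0 => [|j ji].
  by rewrite submxcol_diag_indic mem_set // scale1r.
rewrite submxcol_diag_indic memNset ?scale0r // => Oj.
by have /seteqP[/(_ (grid_point R q)) + _] := tO j i I I ji; apply.
Qed.

Lemma diag_indic_partition0 (R : realType) (d s nu : nat) (n : 'I_d -> nat)
    (Omega : 'I_nu -> set 'rV[R]_d) (X : set 'rV[R]_d) (i j : 'I_nu) :
  is_partition Omega X -> i != j ->
  diag_indic n s (Omega i) *m diag_indic n s (Omega j) = 0.
Proof.
move=> [/trivIsetP tO _] ij.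
by rewrite diag_indic_mul tO // diag_indic0.
Qed.

Theorem theorem6p2 (R : realType) (d s nu : nat)
    (hd : (0 < d)%N) (hs : (0 < s)%N) (hnu : (0 < nu)%N)
    (n : 'I_d -> nat) (hn : forall k, (0 < n k)%N)
    (Omega : 'I_nu -> set 'rV[R]_d)
    (hOmega : is_partition Omega (unit_cube R d)) :
  (forall A : 'M[R[i]]_(bsize n s),
     A \in dom_AS n s Omega -> P_AS Omega A = P_BJ Omega A) /\
  (forall A : 'M[R[i]]_(bsize n s),
     A \in dom_MS n s Omega -> P_MS Omega A = P_BGS Omega A).
Proof.
pose E i := diag_indic n s (Omega i).
have sumE : \sum_(i < nu) E i = 1%:M by exact: sum_diag_indic.
have EE0 i j : i != j -> E i *m E j = 0 by exact: diag_indic_partition0 hOmega.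
split=> A; rewrite inE => -[domA /= uA];
  have {}domA i : Rop (Omega i) A \in unitmx by exact: domA.
  have inv : AS_sum Omega A *m P_BJ Omega A = 1%:M.
    apply: (@additive_schwarz_mul_block_jacobi _ _ E) => //.
    - move=> i j ij; rewrite -RIE_mul_indic.
      by rewrite -[LHS]/(RIE (Omega i) A *m E i *m E j) -mulmxA EE0 // mulmx0.
    - by move=> i; exact: RIE_mul_indic.
    - by move=> i; exact: RIE_mul_indic_local.
  by rewrite /P_AS -[LHS]mulmx1 -inv mulKmx.
pose G i := RIE (Omega i) A.
have sweep : MS_factor Omega A = 1%:M - sweep_error A (ext0 G) nu.
  congr (_ - _); apply: eq_bigr => i _.
  by rewrite -[(nu - i.+1)%N]/(nat_of_ord (rev_ord i)) ext0E.
have LA : P_BGS Omega A *m MS_factor Omega A = A.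
  rewrite sweep -[RHS](@block_gauss_seidel_mul_error _ A (ext0 E) (ext0 G) nu).
  - congr (_ *m _); apply: eq_bigr => i _; apply: eq_bigr => j _.
    by rewrite !ext0E.
  - move=> i j lti ltj; rewrite (ext0E E (Ordinal lti)) (ext0E G (Ordinal ltj)).
    move=> ij; rewrite /G -indic_mul_RIE.
    rewrite -[LHS]/(E (Ordinal lti) *m (E (Ordinal ltj) *m G (Ordinal ltj))).
    by rewrite mulmxA EE0 // mul0mx.
  - move=> i lti; rewrite (ext0E E (Ordinal lti)) (ext0E G (Ordinal lti)).
    exact: indic_mul_RIE_local.
  - by rewrite -[RHS]sumE; apply: eq_bigr => i _; rewrite ext0E.
by rewrite /P_MS -[X in X *m _]LA mulmxK.
Qed.
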